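(* Let $X$ be a non-negative random variable with pdf $f$ and cdf $F$, let $n$ be a positive integer, let $\alpha>0$, $\alpha\neq 1$, and let $t>0$ with $F(t)>0$. Put $A=\frac{1}{F^{\alpha}(t)}$, $\lambda=\frac{1}{A}\left[(1-\alpha)\mathcal{CE}_{\alpha}(X;t)+1\right]$, and $$m_{1}=\frac{1}{1-\alpha}\left(A^{n}\prod_{i=1}^{n}\left[\int_{0}^{\lambda}\left(\frac{F(x)}{F(t)}\right)^{\alpha(i-1)}dx\right]-1\right),$$ $$M_{1}=\frac{1}{1-\alpha}\left(A^{n}\prod_{i=1}^{n}\left[\int_{t-\lambda}^{t}\left(\frac{F(x)}{F(t)}\right)^{\alpha(i-1)}dx\right]-1\right).$$ Then: (i) for $0<\alpha<1$, $m_{1}<\mathcal{CE}_{\alpha}(\boldsymbol X_{\rm MRSSU};t)<M_{1}$; (ii) for $\alpha>1$, $M_{1}<\mathcal{CE}_{\alpha}(\boldsymbol X_{\rm MRSSU};t)<m_{1}$.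
   Context: $X$ is non-negative and absolutely continuous; $F^{\alpha}(t)=[F(t)]^\alpha$. The dynamic cumulative Tsallis entropy of order $\alpha>0$, $\alpha\neq1$, of $X$ is $$\mathcal{CE}_{\alpha}(X;t)=\frac{1}{1-\alpha}\left(\int_{0}^{t}\left(\frac{F(x)}{F(t)}\right)^{\alpha}dx-1\right).$$ $\boldsymbol X_{\rm MRSSU}$ (maximum ranked set sampling with unequal samples, size $n$) is a vector of $n$ independent random variables whose $i$-th component is the maximum of a simple random sample of size $i$ from $X$, with cdf $[F(x)]^i$; its dynamic cumulative Tsallis entropy is $$\mathcal{CE}_{\alpha}(\boldsymbol X_{\rm MRSSU};t)=\frac{1}{1-\alpha}\left[\prod_{i=1}^{n}\int_{0}^{t}\left(\frac{F(x)}{F(t)}\right)^{i\alpha}dx-1\right].$$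
   Formalization: The strict inequalities are proved for n ≥ 2 only; for n = 1 they are replaced by ≤, since then m_1 = CE_α(X_MRSSU;t) = M_1 for every X, α and t, so the strict claim is false there. *)

(* Defs.v *)
From HB Require Import structures.
From mathcomp Require Import all_boot all_order all_algebra.
From mathcomp Require Import all_classical all_reals all_analysis.

Set Implicit Arguments.
Unset Strict Implicit.
Unset Printing Implicit Defensive.

Import Order.TTheory GRing.Theory Num.Theory.
Import numFieldNormedType.Exports.

Local Open Scope classical_set_scope.
Local Open Scope ring_scope.

(* f is a probability density function of X with respect to Lebesgue measure;
   its existence is the absolute continuity of X. *)
Definition is_pdf (d : measure_display) (T : measurableType d) (R : realType)
    (P : probability T R) (X : {RV P >-> R}) (f : R -> R) : Prop :=
  [/\ measurable_fun [set: R] f,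
      (forall x, 0 <= f x) &
      forall U : set R, measurable U ->
        distribution P X U = (\int[lebesgue_measure]_(x in U) (f x)%:E)%E].

(* The cdf of the library takes values in \bar R. *)
Definition rcdf (d : measure_display) (T : measurableType d) (R : realType)
    (P : probability T R) (X : {RV P >-> R}) (x : R) : R :=
  fine (cdf X x).

(* \int_a^b (F(x) / F(t))^p dx; note that 0 `^ p = 0 for p != 0 and that
   0 `^ 0 = 1, so that the integrand is the constant 1 when p = 0. *)
Definition int_powR_ratio (R : realType) (F : R -> R) (t p a b : R) : R :=
  \int[lebesgue_measure]_(x in `[a, b]) (F x / F t) `^ p.

Definition CTsallis (R : realType) (F : R -> R) (alpha t : R) : R :=
  (1 - alpha)^-1 * (int_powR_ratio F t alpha 0 t - 1).

(* Entropy of the vector of n independent components, the i-th one being the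
   maximum of a simple random sample of size i from F, with cdf F ^+ i; thus
   ((F x) ^+ i / (F t) ^+ i) `^ alpha = (F x / F t) `^ (i%:R * alpha). *)
Definition CTsallis_MRSSU (R : realType) (F : R -> R) (n : nat)
    (alpha t : R) : R :=
  (1 - alpha)^-1 *
  (\prod_(1 <= i < n.+1) int_powR_ratio F t (i%:R * alpha) 0 t - 1).

(* Main.v *)
Require Import Defs.
From HB Require Import structures.
From mathcomp Require Import all_boot all_order all_algebra.
From mathcomp Require Import all_classical all_reals all_analysis.
From mathcomp Require Import measurable_realfun ring lra.

Import Order.TTheory GRing.Theory Num.Theory.
Import numFieldNormedType.Exports.

Local Open Scope classical_set_scope.
Local Open Scope ring_scope.

(* With h = (F / F t)^(alpha (i - 1)) non-decreasing and
   0 <= g = (F / F t)^alpha <= A, whose integral over [0, t] is A lambda,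
   Steffensen's inequality bounds the integral of h g between A times the
   integrals of h over [0, lambda] and over [t - lambda, t]; for i = 1, where
   h = 1, all three are equal. Multiplying over i gives the theorem, the sign of
   1 - alpha deciding the direction. Both halves of Steffensen's inequality say
   that the integral of h k is non-negative when h is non-decreasing and k has
   integral zero and changes sign once, from negative to positive:
   k = g - A 1_[0, lambda] or k = A 1_[t - lambda, t] - g. *)

(** * Positivity and integrability on a compact interval *)

(** If the integral vanished, [k] would be zero almost everywhere on [[a, b]], and a null set would
    contain []x, y[], whose measure is [y - x > 0]. *)
Lemma Rintegral_itv_gt0 {R : realType} {a b} (x y : R) {k : R -> R} :
  (@lebesgue_measure R).-integrable `[a, b] (EFin \o k) ->
  {in `[a, b], forall z, 0 <= k z} ->
  a <= x -> x < y -> y <= b -> {in `]x, y[, forall z, k z != 0} ->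
  0 < \int[lebesgue_measure]_(z in `[a, b]) k z.
Proof.
move=> ik k_ge0 ax xy yb k_neq0.
rewrite lt_neqAle Rintegral_ge0 ?andbT; last by move=> z /= /k_ge0.
apply/eqP => /esym ik0.
have mk := measurable_int _ ik.
have : (\int[lebesgue_measure]_(z in `[a, b]) `|(EFin \o k) z| = 0)%E.
  transitivity (\int[lebesgue_measure]_(z in `[a, b]) (k z)%:E)%E.
    by apply: eq_integral => z /[!inE] /= /k_ge0 kz; rewrite ger0_norm.
  by rewrite -(fineK (integrable_fin_num _ ik))//= -/(Rintegral _ _ _) ik0.
move=> /(ae_eq_integral_abs _ _ mk)
  -/(_ ltac:(exact: measurable_itv)) [N [mN N0 sN]].
have : (@lebesgue_measure R `]x, y[ <= lebesgue_measure N)%E.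
  apply: le_measure; rewrite ?inE//.
  move=> z /= zxy; apply: sN => /= kz0.
  have := k_neq0 _ zxy; rewrite -eqe.
  suff /kz0 -> : `[a, b]%classic z by rewrite eqxx.
  rewrite /= in_itv/=; move: zxy; rewrite in_itv/= => /andP[xz zy].
  by rewrite (le_trans ax (ltW xz)) (le_trans (ltW zy) yb).
rewrite N0 lebesgue_measure_itv/= lte_fin xy -EFinB lee_fin.
by rewrite leNgt subr_gt0 xy.
Qed.

Lemma integrable_itv_bounded {R : realType} {a b M : R} {k : R -> R} :
  measurable_fun setT k -> {in `[a, b], forall z, `|k z| <= M} ->
  (@lebesgue_measure R).-integrable `[a, b] (EFin \o k).
Proof.
move=> mk kM; apply: measurable_bounded_integrable => //=.
- rewrite lebesgue_measure_itv/=; case: ifP => // _.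
  by rewrite -EFinB ltry.
- exact: measurable_funTS.
- exists M; split; first by rewrite num_real.
  by move=> B MB z /= /kM kz; exact: le_trans kz (ltW MB).
Qed.

Lemma nondecreasing_itv_normr_le {R : realType} {a b : R} {h : R -> R} :
  nondecreasing_fun h -> {in `[a, b], forall z, `|h z| <= `|h a| + `|h b|}.
Proof.
move=> ndh z; rewrite in_itv/= => /andP[/ndh h1 /ndh h2]; rewrite ler_norml.
have := ler_norm (- h a); have := ler_norm (h b); rewrite normrN.
by have := normr_ge0 (h a); have := normr_ge0 (h b); move=> *; lra.
Qed.

(* Subtracting the constant [h c] from [h] does not change the integral and
   makes the integrand non-negative. *)
Lemma Rintegral_sign_change_gt0 (R : realType) (a b c x y M : R)
    (h k : R -> R) :
  nondecreasing_fun h -> measurable_fun setT k ->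
  {in `[a, b], forall z, `|k z| <= M} ->
  {in `[a, b], forall z, (z < c -> k z <= 0) /\ (c < z -> 0 <= k z)} ->
  \int[lebesgue_measure]_(z in `[a, b]) k z = 0 ->
  a <= x -> x < y -> y <= b ->
  {in `]x, y[, forall z, h z != h c /\ k z != 0} ->
  0 < \int[lebesgue_measure]_(z in `[a, b]) (h z * k z).
Proof.
move=> ndh mk kM ksgn k0 ax xy yb hk.
have ik := integrable_itv_bounded mk kM.
have mhk : measurable_fun setT (fun z => h z * k z).
  by apply: measurable_funM => //; exact: nondecreasing_measurable.
have ihk : (@lebesgue_measure R).-integrable `[a, b]
    (EFin \o (fun z => h z * k z)).
  apply: (integrable_itv_bounded (M := (`|h a| + `|h b|) * M) mhk) => z zab.
  by rewrite normrM ler_pM// ?kM// nondecreasing_itv_normr_le.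
have ick : (@lebesgue_measure R).-integrable `[a, b]
    (EFin \o (fun z => h c * k z)).
  exact: (integrableZl _ (h c) ik).
have -> : \int[lebesgue_measure]_(z in `[a, b]) (h z * k z) =
          \int[lebesgue_measure]_(z in `[a, b]) (h z * k z - h c * k z).
  by rewrite RintegralB// RintegralZl// k0 mulr0 subr0.
apply: (Rintegral_itv_gt0 x y) => //.
- exact: (integrableB _ ihk ick).
- move=> z zab; have [kl kg] := ksgn _ zab; rewrite -mulrBl.
  have [zc|cz|->] := ltgtP z c; last by rewrite subrr mul0r.
  + by rewrite mulr_le0 ?kl// subr_le0 ndh// ltW.
  + by rewrite mulr_ge0 ?kg// subr_ge0 ndh// ltW.
- by move=> z /hk[hz kz]; rewrite -mulrBl mulf_neq0// subr_eq0.
Qed.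

(** * Steffensen's inequality in strict form *)

Section Steffensen.
Variables (R : realType) (a b A lambda x y : R) (g h : R -> R).
Hypotheses (ndh : nondecreasing_fun h) (mg : measurable_fun setT g).
Hypothesis g_itv : forall z, 0 <= g z <= A.
Hypothesis lambda_itv : 0 <= lambda <= b - a.
Hypothesis int_g : \int[lebesgue_measure]_(z in `[a, b]) g z = A * lambda.
Hypotheses (ax : a <= x) (xy : x < y) (yb : y <= b).
Hypothesis g_oo : {in `]x, y[, forall z, 0 < g z < A}.

Let mh : measurable_fun setT h.
Proof. exact: nondecreasing_measurable. Qed.

Let A_ge0 : 0 <= A.
Proof. by have /andP[/le_trans] := g_itv 0; apply. Qed.

Let ih := integrable_itv_bounded mh (nondecreasing_itv_normr_le (a := a)
  (b := b) ndh).

Let gA z : `|g z| <= A.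
Proof. by have /andP[g0] := g_itv z; rewrite ger0_norm. Qed.

Let ig : (@lebesgue_measure R).-integrable `[a, b] (EFin \o g).
Proof. by apply: (integrable_itv_bounded (M := A)) => // z _. Qed.

Let ihg : (@lebesgue_measure R).-integrable `[a, b]
  (EFin \o (fun z => h z * g z)).
Proof.
apply: (integrable_itv_bounded (M := (`|h a| + `|h b|) * A)).
  exact: measurable_funM.
by move=> z zab; rewrite normrM ler_pM// nondecreasing_itv_normr_le.
Qed.

(** Both sides of Steffensen's inequality thereby become integrals over [[a, b]], whose difference
    is the integral of a single product. *)
Let Rintegral_indic_itv (k : R -> R) (u v : R) : a <= u -> v <= b ->
  (@lebesgue_measure R).-integrable `[a, b] (EFin \o k) ->
  (@lebesgue_measure R).-integrable `[a, b]
      (EFin \o (fun z => k z * (A * \1_(`[u, v] : set R) z))) /\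
  \int[lebesgue_measure]_(z in `[a, b]) (k z * (A * \1_(`[u, v] : set R) z)) =
  A * \int[lebesgue_measure]_(z in `[u, v]) k z.
Proof.
move=> au vb ik.
have uvab : `[u, v] `<=` `[a, b].
  by apply: subset_itv; rewrite bnd_simp.
have E : (fun z => k z * (A * \1_(`[u, v] : set R) z)) =
    (fun z => A * (k \_ (`[u, v] : set R)) z).
  apply/funext => z; rewrite patchE indicE.
  by case: ifP => _; rewrite ?mulr1 ?mulr0// mulrC.
have ir : (@lebesgue_measure R).-integrable `[a, b]
    (EFin \o (k \_ (`[u, v] : set R))).
  rewrite -restrict_EFin; apply/integrable_restrict => //=.
  by apply: integrableS ik => //; rewrite ?setIidr ?setIidl.
rewrite E; split; first exact: (integrableZl _ A ir).
by rewrite RintegralZl// -Rintegral_mkcondr setIidr.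
Qed.

Let Rintegral_indic_cst (u v : R) : a <= u -> u <= v -> v <= b ->
  (@lebesgue_measure R).-integrable `[a, b]
      (EFin \o (fun z => A * \1_(`[u, v] : set R) z)) /\
  \int[lebesgue_measure]_(z in `[a, b]) (A * \1_(`[u, v] : set R) z) =
  A * (v - u).
Proof.
move=> au uv vb.
have i1 : (@lebesgue_measure R).-integrable `[a, b] (EFin \o cst 1).
  by apply: (integrable_itv_bounded (M := 1)) => // z _; rewrite normr1.
have E : (fun z => A * \1_(`[u, v] : set R) z) =
         (fun z => cst 1 z * (A * \1_(`[u, v] : set R) z)).
  by apply/funext => z; rewrite /= mul1r.
rewrite E; have [? ->] := Rintegral_indic_itv _ _ _ au vb i1; split=> //.
rewrite Rintegral_cst//= mul1r lebesgue_measure_itv/= lte_fin.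
case: ltP => [_|vu]; first by rewrite -EFinB.
by have -> : u = v by [apply/eqP; rewrite eq_le uv vu]; rewrite subrr.
Qed.

(** The function [g - A * j], with [j] the indicator of [[a, a + lambda]], is non-positive before
    [a + lambda] because [g <= A], non-negative after it because [0 <= g], and has integral zero
    because [g] has integral [A * lambda]. It does not vanish on []x, y[], where [0 < g < A]; this
    gives strictness. *)
Lemma Steffensen_left :
  {in `]x, y[, forall z, h z != h (a + lambda)} ->
  A * \int[lebesgue_measure]_(z in `[a, a + lambda]) h z <
  \int[lebesgue_measure]_(z in `[a, b]) (h z * g z).
Proof.
move=> hc; have /andP[l0 lba] := lambda_itv.
have alb : a + lambda <= b by rewrite addrC -lerBrDr.
have al : a <= a + lambda by rewrite lerDl.
pose j := \1_(`[a, a + lambda] : set R) : R -> R.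
have [ihj Ehj] := Rintegral_indic_itv _ _ _ (lexx a) alb ih.
have [ij Ej] := Rintegral_indic_cst _ _ (lexx a) al alb.
rewrite -Ehj -subr_gt0 -RintegralB//.
under eq_Rintegral do rewrite -mulrBr.
have jE z : z \in `[a, b] -> j z = (z <= a + lambda)%R%:R.
  rewrite in_itv/= => /andP[az _]; rewrite /j indicE mem_setE.
  by rewrite /= in_itv/= az.
apply: (@Rintegral_sign_change_gt0 _ a b (a + lambda) x y A) => //.
- apply: measurable_funB => //; apply: measurable_funM => //.
- move=> z zab; rewrite -/(j z) jE//; have := g_itv z.
  by case: (leP z (a + lambda)) => _; rewrite ?mulr1n ?mulr0n ?mulr1 ?mulr0 =>
    /andP[? ?]; rewrite ler_norml; lra.
- move=> z zab; rewrite -/(j z) jE//; have := g_itv z.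
  by case: (leP z (a + lambda)) => ?; rewrite ?mulr1n ?mulr0n ?mulr1 ?mulr0 =>
    /andP[? ?]; split => ?; lra.
- by rewrite RintegralB// int_g Ej addrAC subrr add0r subrr.
- move=> z zxy; split; first exact: hc.
  have /andP[gz0 gzA] := g_oo _ zxy.
  rewrite -/(j z) jE; last first.
    move: zxy; rewrite !in_itv/= => /andP[xz zy].
    by rewrite (le_trans ax (ltW xz)) (le_trans (ltW zy) yb).
  by case: (leP z (a + lambda)) => _; rewrite ?mulr1n ?mulr0n ?mulr1 ?mulr0
    subr_eq0 neq_lt ?gz0 ?gzA ?orbT.
Qed.

(** Mirror image of the previous argument: [A * j - g], with [j] the indicator of [[b - lambda, b]],
    changes sign at [b - lambda]. *)
Lemma Steffensen_right :
  {in `]x, y[, forall z, h z != h (b - lambda)} ->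
  \int[lebesgue_measure]_(z in `[a, b]) (h z * g z) <
  A * \int[lebesgue_measure]_(z in `[b - lambda, b]) h z.
Proof.
move=> hc; have /andP[l0 lba] := lambda_itv.
have abl : a <= b - lambda by rewrite lerBrDr addrC -lerBrDr.
have lb : b - lambda <= b by rewrite gerBl.
pose j := \1_(`[b - lambda, b] : set R) : R -> R.
have [ihj Ehj] := Rintegral_indic_itv _ _ _ abl (lexx b) ih.
have [ij Ej] := Rintegral_indic_cst _ _ abl lb (lexx b).
rewrite -Ehj -subr_gt0 -RintegralB//.
under eq_Rintegral do rewrite -mulrBr.
have jE z : z \in `[a, b] -> j z = (b - lambda <= z)%R%:R.
  rewrite in_itv/= => /andP[_ zb]; rewrite /j indicE mem_setE.
  by rewrite /= in_itv/= zb andbT.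
apply: (@Rintegral_sign_change_gt0 _ a b (b - lambda) x y A) => //.
- apply: measurable_funB => //; apply: measurable_funM => //.
- move=> z zab; rewrite -/(j z) jE//; have := g_itv z.
  by case: (leP (b - lambda) z) => _; rewrite ?mulr1n ?mulr0n ?mulr1 ?mulr0 =>
    /andP[? ?]; rewrite ler_norml; lra.
- move=> z zab; rewrite -/(j z) jE//; have := g_itv z.
  by case: (leP (b - lambda) z) => ?; rewrite ?mulr1n ?mulr0n ?mulr1 ?mulr0 =>
    /andP[? ?]; split => ?; lra.
- by rewrite RintegralB// int_g Ej subKr subrr.
- move=> z zxy; split; first exact: hc.
  have /andP[gz0 gzA] := g_oo _ zxy.
  rewrite -/(j z) jE; last first.
    move: zxy; rewrite !in_itv/= => /andP[xz zy].
    by rewrite (le_trans ax (ltW xz)) (le_trans (ltW zy) yb).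
  by case: (leP (b - lambda) z) => _; rewrite ?mulr1n ?mulr0n ?mulr1 ?mulr0
    subr_eq0 neq_lt ?gz0 ?gzA ?orbT.
Qed.

End Steffensen.

(** * Integrals of powers of the ratio [F x / F t] *)

Section int_powR_ratio_cdf.
Variables (R : realType) (F : R -> R) (t alpha : R).
Hypothesis ndF : nondecreasing_fun F.
Hypothesis F_itv : forall x, 0 <= F x <= 1.
Hypothesis F0 : F 0 = 0.
Hypothesis cF : {within `[0, t], continuous F}.
Hypotheses (alpha_gt0 : 0 < alpha) (t_gt0 : 0 < t) (Ft_gt0 : 0 < F t).

Let A := (F t `^ alpha)^-1.
Let lambda := A^-1 * int_powR_ratio F t alpha 0 t.
Let G (p x : R) := (F x / F t) `^ p.

Let A_gt0 : 0 < A. Proof. by rewrite invr_gt0 powR_gt0. Qed.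

Let ratio_ge0 x : 0 <= F x / F t.
Proof. by rewrite divr_ge0 ?(ltW Ft_gt0)//; case/andP: (F_itv x). Qed.

Let ndG p : 0 <= p -> nondecreasing_fun (G p).
Proof.
move=> p0 x y xy; apply: ge0_ler_powR; rewrite ?nnegrE//.
by rewrite ler_pM2r ?invr_gt0// ndF.
Qed.

Let mG p : 0 <= p -> measurable_fun setT (G p).
Proof. by move=> p0; apply: nondecreasing_measurable => //; exact: ndG. Qed.

Let G_t p : G p t = 1.
Proof. by rewrite /G divff ?gt_eqF// powR1. Qed.

Let iG p : 0 <= p -> (@lebesgue_measure R).-integrable `[0, t] (EFin \o G p).
Proof.
move=> p0; apply: (integrable_itv_bounded (M := 1)); first exact: mG.
move=> x; rewrite in_itv/= => /andP[_ xt].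
by rewrite ger0_norm ?powR_ge0// -(G_t p) ndG.
Qed.

(** Since [F <= 1], the ratio is at most [(F t)^-1], whose power [alpha] is [A]. The bound thus
    holds on the whole line and not only up to [t]. *)
Let G_itv x : 0 <= G alpha x <= A.
Proof.
have /andP[Fx0 Fx1] := F_itv x.
have -> : A = (F t)^-1 `^ alpha.
  by rewrite /A -(powR_inv1 (ltW Ft_gt0)) -powRrM mulN1r powRN.
rewrite powR_ge0/=; apply: ge0_ler_powR; rewrite ?nnegrE ?invr_ge0//;
  try exact: ltW.
by rewrite ler_piMl// invr_ge0 ltW.
Qed.

(* Continuity of [F] provides two levels between [0] and [F t], on the same
   side of [F c], at which Steffensen's inequality is strict. *)
Let strict_itv c : exists x y, [/\ 0 <= x, x < y, y <= t &
  {in `]x, y[, forall z, 0 < F z < F t /\ F z != F c}].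
Proof.
have Ft := Ft_gt0.
have [u [v [u0 uv vt uvc]]] : exists u v, [/\ 0 < u, u < v, v < F t &
    forall w, u <= w <= v -> w != F c].
  (* Both levels are taken in the half of []0, F t[] that cannot contain [F c]. *)
  have [Fc|Fc] := ltP (F c) (F t / 2).
    exists (2 / 3 * F t), (3 / 4 * F t); split; try lra.
    by move=> w /andP[uw wv]; rewrite gt_eqF//; lra.
  exists (1 / 4 * F t), (1 / 3 * F t); split; try lra.
  by move=> w /andP[uw wv]; rewrite lt_eqF//; lra.
have ivt w : 0 < w < F t -> exists2 x, x \in `[0, t] & F x = w.
  move=> /andP[w0 wt]; apply: IVT => //; first exact: ltW.
  by rewrite F0 min_l ?max_r ?ltW.
have [|x] := ivt u; first by rewrite u0 (lt_trans uv).
rewrite in_itv/= => /andP[x0 xt] Fx.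
have [|y] := ivt v; first by rewrite vt (lt_trans u0).
rewrite in_itv/= => /andP[y0 yt] Fy.
exists x, y; split => //.
  by rewrite ltNge; apply/negP => /ndF; rewrite Fx Fy leNgt uv.
move=> z; rewrite in_itv/= => /andP[/ltW/ndF + /ltW/ndF].
rewrite Fx Fy => uz zv; split; last by rewrite uvc// uz.
by rewrite (lt_le_trans u0 uz) (le_lt_trans zv vt).
Qed.

Let G_inj p x y : 0 < p -> F x != F y -> G p x != G p y.
Proof.
move=> p0; apply: contra => /eqP.
move=> /(powR_injective p0); rewrite !nnegrE.
move=> /(_ (ratio_ge0 x) (ratio_ge0 y)).
by move=> /(mulIf _)-> //; rewrite invr_eq0 gt_eqF.
Qed.

(** When [F t = 1] the bound [A] is itself 1, so strictness has to come from [F x < F t], through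
    [G alpha x < G alpha t = 1 <= A]. *)
Let G_lt x : F x < F t -> G alpha x < A.
Proof.
move=> Fxt; apply: (@lt_le_trans _ _ 1); last first.
  by have /andP[_] := G_itv t; rewrite G_t.
rewrite -(G_t alpha); apply: gt0_ltr_powR; rewrite ?nnegrE//.
by rewrite ltr_pM2r ?invr_gt0.
Qed.

Let G_gt0 p x : 0 < F x -> 0 < G p x.
Proof. by move=> Fx; rewrite powR_gt0 ?divr_gt0. Qed.

Lemma int_powR_ratio_gt0 p : 0 <= p -> 0 < int_powR_ratio F t p 0 t.
Proof.
(* The point [0] is an arbitrary choice: only [0 < F z] on []x, y[] is used. *)
move=> p0; have [x [y [x0 xy yt zxy]]] := strict_itv 0.
apply: (Rintegral_itv_gt0 x y); rewrite ?iG//.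
- by move=> z _; exact: powR_ge0.
- by move=> z /zxy[/andP[/(G_gt0 p) Gz _] _]; rewrite gt_eqF.
Qed.

Lemma int_powR_ratio_ge0 p a b : 0 <= int_powR_ratio F t p a b.
Proof. by apply: Rintegral_ge0 => x _; exact: powR_ge0. Qed.

Let int_alpha : int_powR_ratio F t alpha 0 t = A * lambda.
Proof. by rewrite /lambda mulVKf// gt_eqF. Qed.

(** Obtained by integrating [0 <= G alpha <= A] over [[0, t]]; it places [[0, lambda]] and
    [[t - lambda, t]] inside [[0, t]]. *)
Let lambda_itv : 0 <= lambda <= t.
Proof.
rewrite /lambda mulr_ge0 ?invr_ge0 ?powR_ge0 ?int_powR_ratio_ge0//=.
rewrite ler_pdivrMl//.
apply: (@le_trans _ _ (\int[lebesgue_measure]_(x in `[0, t]) A)).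
  apply: le_Rintegral => //; first exact: (iG _ (ltW alpha_gt0)).
    apply: (integrable_itv_bounded (M := A)) => // z _.
    by rewrite ger0_norm// ltW.
  by move=> x _; case/andP: (G_itv x).
by rewrite Rintegral_cst//= lebesgue_measure_itv/= lte_fin t_gt0 oppr0 addr0.
Qed.

Lemma int_powR_ratio0 a b : a <= b -> int_powR_ratio F t 0 a b = b - a.
Proof.
rewrite /int_powR_ratio le_eqVlt => /predU1P[<-|ab].
  by rewrite set_itv1 Rintegral_set1 subrr.
under eq_Rintegral do rewrite powRr0.
by rewrite Rintegral_cst//= lebesgue_measure_itv/= lte_fin ab -EFinB mul1r.
Qed.

Let int_powR_ratioD p : 0 <= p -> int_powR_ratio F t (p + alpha) 0 t =
  \int[lebesgue_measure]_(x in `[0, t]) (G p x * G alpha x).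
Proof.
move=> p0; apply: eq_Rintegral => x _; rewrite powRD//.
(* The ratio may be zero, where the law of exponents needs [p + alpha != 0]. *)
by rewrite gt_eqF// addrC ltr_wpDr.
Qed.

(** Steffensen's inequality for [h = G p] and [g = G alpha]. As [p > 0], distinct values of [F] give
    distinct values of [G p], which yields the strictness. *)
Lemma int_powR_ratio_Steffensen p : 0 < p ->
  A * int_powR_ratio F t p 0 lambda < int_powR_ratio F t (p + alpha) 0 t
  < A * int_powR_ratio F t p (t - lambda) t.
Proof.
move=> p0; rewrite int_powR_ratioD ?ltW//.
have lt0 : 0 <= lambda <= t - 0 by rewrite subr0 lambda_itv.
have mGa := mG _ (ltW alpha_gt0); have ndGp := ndG _ (ltW p0).
apply/andP; split.
  have [x [y [x0 xy yt zxy]]] := strict_itv lambda.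
  have := @Steffensen_left R 0 t A lambda x y (G alpha) (G p).
  rewrite add0r; apply => // z /zxy[/andP[z0 zt] zc]; last exact: G_inj.
  by rewrite G_gt0// G_lt.
have [x [y [x0 xy yt zxy]]] := strict_itv (t - lambda).
apply: (@Steffensen_right R 0 t A lambda x y (G alpha) (G p)) => //;
  move=> z /zxy[/andP[z0 zt] zc]; last exact: G_inj.
by rewrite G_gt0// G_lt.
Qed.

Lemma prod_int_powR_ratio_Steffensen n : (0 < n)%N ->
  (A ^+ n * \prod_(1 <= i < n.+1)
      int_powR_ratio F t (alpha * (i%:R - 1)) 0 lambda <
   \prod_(1 <= i < n.+1) int_powR_ratio F t (i%:R * alpha) 0 t
   ?<= if (n == 1%N)) /\
  (\prod_(1 <= i < n.+1) int_powR_ratio F t (i%:R * alpha) 0 t <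
   A ^+ n * \prod_(1 <= i < n.+1)
      int_powR_ratio F t (alpha * (i%:R - 1)) (t - lambda) t
   ?<= if (n == 1%N)).
Proof.
case: n => // n _.
(* Each index receives one factor [A], and the index 1, of exponent zero, is set apart. *)
have AX (a b : R) : A ^+ n.+1 * \prod_(1 <= i < n.+2)
      int_powR_ratio F t (alpha * (i%:R - 1)) a b =
    A * int_powR_ratio F t 0 a b *
    \prod_(2 <= i < n.+2) (A * int_powR_ratio F t (alpha * (i%:R - 1)) a b).
  have -> : A ^+ n.+1 = \prod_(1 <= i < n.+2) A.
    by rewrite prodr_const_nat subn1.
  rewrite -big_split/=.
  by rewrite big_ltn// subrr mulr0.
have /andP[l0 lt] := lambda_itv.
(* With exponent zero the integral is the length of the interval, [lambda] on either side, so the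
   factor of index 1 is common to the three products. *)
have E0 : A * int_powR_ratio F t 0 0 lambda = int_powR_ratio F t alpha 0 t.
  by rewrite int_powR_ratio0// subr0 int_alpha.
have E1 : A * int_powR_ratio F t 0 (t - lambda) t =
    int_powR_ratio F t alpha 0 t.
  by rewrite int_powR_ratio0 ?gerBl// subKr int_alpha.
rewrite !AX E0 E1 [X in (_ < X ?<= if _) /\ _]big_ltn//.
rewrite [X in _ /\ (X < _ ?<= if _)]big_ltn// !mul1r.
have I_gt0 := int_powR_ratio_gt0 _ (ltW alpha_gt0).
(* The remaining indices start at 2: for sample size 1 their products are empty and equality holds;
   otherwise they are non-empty products of strictly ordered factors. *)
case: n AX => [|n] _ /=; first by rewrite !big_geq.
have S i : (2 <= i < n.+3)%N ->
    A * int_powR_ratio F t (alpha * (i%:R - 1)) 0 lambda <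
    int_powR_ratio F t (i%:R * alpha) 0 t <
    A * int_powR_ratio F t (alpha * (i%:R - 1)) (t - lambda) t.
  move=> /andP[i2 _].
  have -> : i%:R * alpha = alpha * (i%:R - 1) + alpha by ring.
  by apply: int_powR_ratio_Steffensen; rewrite mulr_gt0// subr_gt0 ltr1n.
split; rewrite ltr_pM2l//; apply: ltr_prod_nat => // i /S /andP[Sl Sr].
  by rewrite Sl andbT mulr_ge0 ?(ltW A_gt0) ?int_powR_ratio_ge0.
by rewrite Sr andbT int_powR_ratio_ge0.
Qed.

End int_powR_ratio_cdf.

(** * The cdf of a non-negative absolutely continuous variable *)

Section rcdf_absolutely_continuous.
Context {d} {T : measurableType d} {R : realType} {P : probability T R}.
Context {X : {RV P >-> R}} {f : R -> R}.
Hypotheses (X_ge0 : {ae P, forall w, 0 <= X w}) (f_pdf : is_pdf X f).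

Lemma rcdf_itv x : 0 <= rcdf X x <= 1.
Proof.
rewrite fine_ge0//= -lee_fin fineK ?fin_num_measure//.
exact: cdf_le1.
Qed.

Lemma nondecreasing_rcdf : nondecreasing_fun (rcdf X).
Proof.
move=> x y xy; rewrite fine_le ?fin_num_measure//.
exact: cdf_nondecreasing.
Qed.

(** The event [X < 0] is null by non-negativity, and the point [0] has no mass because the law has a
    density. *)
Lemma rcdf0 : rcdf X 0 = 0.
Proof.
have [mf f0 Xf] := f_pdf.
suff : distribution P X `]-oo, 0] = 0%E by rewrite /rcdf /cdf => ->.
rewrite -(@setUitv1 _ _ -oo%O _ true)// measureU//=; last first.
  apply/seteqP; split => // x [] /=; rewrite in_itv/= => x0 xE.
  by rewrite xE ltxx in x0.
rewrite [X in (_ + X)%E](Xf [set 0])// integral_set1 adde0.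
have [N [mN N0 sN]] := X_ge0.
rewrite /distribution /pushforward; apply: subset_measure0 N0 => //.
  exact: measurable_funPTI.
move=> w /=; rewrite in_itv/= => Xw; apply: sN => /=.
by apply/negP; rewrite -ltNge.
Qed.

Lemma integrable_pdf (D : set R) : measurable D ->
  (@lebesgue_measure R).-integrable D (EFin \o f).
Proof.
have [mf f0 Xf] := f_pdf => mD; apply/integrableP; split.
  by apply/measurable_EFinP; exact: measurable_funTS.
under eq_integral do rewrite /= ger0_norm//.
by rewrite -Xf// (le_lt_trans (probability_le1 _ _))// ltry.
Qed.

Lemma rcdf_Rintegral_pdf x : 0 <= x ->
  rcdf X x = \int[lebesgue_measure]_(z in `[0, x]) f z.
Proof.
have [mf f0 Xf] := f_pdf => x0.
rewrite -Rintegral_itv_obnd_cbnd; last exact: integrable_pdf.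
rewrite /Rintegral -Xf// /rcdf /cdf.
rewrite (@itv_bndbnd_setU _ _ _ (BRight 0)) ?bnd_simp// measureU//=; last first.
  apply/seteqP; split => // z [] /=; rewrite !in_itv/= => z0 /andP[].
  by rewrite ltNge z0.
rewrite fineD ?fin_num_measure//.
by have := rcdf0; rewrite /rcdf /cdf => ->; rewrite add0r.
Qed.

(** On [[0, b]] the cdf is the indefinite integral of the integrable function [f]. This continuity
    is what the intermediate value theorem needs to produce the intervals of strictness. *)
Lemma continuous_rcdf b : 0 <= b -> {within `[0, b], continuous (rcdf X)}.
Proof.
move=> b0.
apply: (@subspace_eq_continuous _ _ _
    (fun x => parameterized_integral lebesgue_measure 0 x f)).
  move=> x; rewrite mem_setE in_itv/= => /andP[x0 _].
  exact/esym/rcdf_Rintegral_pdf.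
by apply: parameterized_integral_continuous => //; exact: integrable_pdf.
Qed.

End rcdf_absolutely_continuous.

(* For n = 1 the three quantities coincide, so the strict inequalities are
   asserted for n != 1 and the large ones for n = 1. *)
Theorem theorem3p5 (d : measure_display) (T : measurableType d) (R : realType)
    (P : probability T R) (X : {RV P >-> R}) (f : R -> R)
    (X_ge0 : {ae P, forall w, 0 <= X w})
    (f_pdf : is_pdf X f)
    (n : nat) (n_gt0 : (0 < n)%N)
    (alpha : R) (alpha_gt0 : 0 < alpha) (alpha_neq1 : alpha != 1)
    (t : R) (t_gt0 : 0 < t) (Ft_gt0 : 0 < rcdf X t) :
  let F := rcdf X in
  let A := (F t `^ alpha)^-1 in
  let lambda := A^-1 * ((1 - alpha) * CTsallis F alpha t + 1) in
  let m1 := (1 - alpha)^-1 *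
    (A ^+ n * \prod_(1 <= i < n.+1)
                int_powR_ratio F t (alpha * (i%:R - 1)) 0 lambda - 1) in
  let M1 := (1 - alpha)^-1 *
    (A ^+ n * \prod_(1 <= i < n.+1)
                int_powR_ratio F t (alpha * (i%:R - 1)) (t - lambda) t - 1) in
  let CE := CTsallis_MRSSU F n alpha t in
  (alpha < 1 ->
     (m1 < CE ?<= if (n == 1%N)) /\
     (CE < M1 ?<= if (n == 1%N))) /\
  (1 < alpha ->
     (M1 < CE ?<= if (n == 1%N)) /\
     (CE < m1 ?<= if (n == 1%N))).
Proof.
move=> F A lambda m1 M1 CE.
have [lo up] := @prod_int_powR_ratio_Steffensen R F t alpha nondecreasing_rcdf
  rcdf_itv (rcdf0 X_ge0 f_pdf) (continuous_rcdf X_ge0 f_pdf t (ltW t_gt0))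
  alpha_gt0 t_gt0 Ft_gt0 n n_gt0.
(* Undoing the normalisation of the entropy: [(1 - alpha) * CTsallis F alpha t + 1] is the integral
   itself, as [alpha != 1]. *)
have lambdaE : lambda = A^-1 * int_powR_ratio F t alpha 0 t.
  rewrite /lambda /CTsallis mulVKf ?subrK// subr_eq0 eq_sym.
  exact: alpha_neq1.
move: lo up; rewrite -lambdaE => lo up.
split => alpha1.
  by rewrite !lteif_pM2l ?invr_gt0 ?subr_gt0// !lteifD2r.
by rewrite !lteif_nM2l ?invr_lt0 ?subr_lt0// !lteifD2r.
Qed.
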